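(* Let $p$ be a probability distribution over the joint assignments to a finite set $\mathcal{V}$ of discrete random variables, let $sq$ be a probability distribution over the set of legal statistical queries over $\mathcal{V}$, and let $B$ be a fixed Bayesian net over $\mathcal{V}$. Let $0<\epsilon,\delta<1$, and let $$M_{LSQ} = M_{LSQ}(\epsilon,\delta) = \left\lceil \frac{1}{2\epsilon^2}\ln\frac{2}{\delta}\right\rceil .$$ Let $S_{LSQ}$ be a sample of $M_{LSQ}$ labeled statistical queries $\langle q, p(q)\rangle$, where the queries $q$ are drawn independently at random from $sq$, and each is labeled with its true conditional probability $p(q)$. Let $$\overline{\mathrm{err}}^{S_{LSQ}}(B) = \frac{1}{M_{LSQ}}\sum_{\langle q,p\rangle\in S_{LSQ}} (B(q)-p)^2 .$$ Then $$P\left[\,\left|\overline{\mathrm{err}}^{S_{LSQ}}(B)-\mathrm{err}(B)\right|<\epsilon\,\right]\ \geq\ 1-\delta ,$$ where the probability is over the random draw of $S_{LSQ}$.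
   Context: $\mathcal{V}=\{V_1,\dots,V_N\}$ is a finite set of random variables, each with a finite domain, with a fixed underlying joint distribution $p$. A (legal) statistical query $q$ is a pair $(\mathbf{X}=\mathbf{x};\mathbf{Y}=\mathbf{y})$, where $\mathbf{X},\mathbf{Y}\subset\mathcal{V}$ are disjoint (possibly empty) subsets, $\mathbf{x},\mathbf{y}$ are assignments to them, and $p(\mathbf{Y}=\mathbf{y})>0$; it asks for the value $p(\mathbf{X}=\mathbf{x}\mid\mathbf{Y}=\mathbf{y})$. Write $p(q)=p(\mathbf{x}\mid\mathbf{y})$. $sq(\mathbf{x};\mathbf{y})$ denotes the probability, under $sq$, that the query $(\mathbf{X}=\mathbf{x};\mathbf{Y}=\mathbf{y})$ is asked; $sq$ need not be related to $p$. A Bayesian net $B$ over $\mathcal{V}$ is a directed acyclic graph on $\mathcal{V}$ with a conditional probability table for each node given its parents. $B(q)=B(\mathbf{x}\mid\mathbf{y})\in[0,1]$ denotes the (conditional) probability that $B$ returns for the query. The score (error) of $B$ is $$\mathrm{err}(B)=\sum_{\mathbf{x},\mathbf{y}} sq(\mathbf{x};\mathbf{y})\,[B(\mathbf{x}\mid\mathbf{y})-p(\mathbf{x}\mid\mathbf{y})]^2,$$ the sum being over all assignments to all (disjoint) subsets $\mathbf{X},\mathbf{Y}$ of variables. *)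

(* Defs.v *)
From HB Require Import structures.
From mathcomp Require Import all_boot all_order all_algebra.
From mathcomp Require Import reals exp.

Set Implicit Arguments.
Unset Strict Implicit.
Unset Printing Implicit Defensive.

Import Order.TTheory GRing.Theory Num.Theory.
Local Open Scope ring_scope.

Record dist (R : realType) (T : finType) := Dist {
  pmf :> T -> R;
  pmf_ge0 : forall t, 0 <= pmf t;
  pmf_sum1 : \sum_t pmf t = 1 }.

Definition Pr (R : realType) (T : finType) (d : dist R T) (E : pred T) : R :=
  \sum_(t | E t) d t.

Section Iid.
Variables (R : realType) (T : finType) (d : dist R T) (m : nat).

Definition iid_pmf (s : {ffun 'I_m -> T}) : R := \prod_k d (s k).

Lemma iid_pmf_ge0 s : 0 <= iid_pmf s.
Proof. by apply: prodr_ge0 => k _; apply: pmf_ge0. Qed.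

Lemma iid_pmf_sum1 : \sum_s iid_pmf s = 1.
Proof.
rewrite -(bigA_distr_bigA (fun (_ : 'I_m) t => d t)).
by apply: big1 => k _; apply: pmf_sum1.
Qed.

Definition iid : dist R {ffun 'I_m -> T} := Dist iid_pmf_ge0 iid_pmf_sum1.
End Iid.

Section Queries.
Variables (R : realType) (V : finType) (dom : V -> finType).

Definition assignment : finType := {dffun forall i : V, dom i}.

(* An assignment x to a subset X of the variables; X is the set of those i
   with x i != None. *)
Definition passignment : finType := {dffun forall i : V, option (dom i)}.

Definition vars (x : passignment) : {set V} := [set i | x i != None].

Definition agrees (a : assignment) (x : passignment) : bool :=
  [forall i, if x i is Some v then a i == v else true].

(* The pair (x, y) stands for the query (X = x; Y = y). *)
Definition query : finType := (passignment * passignment)%type.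

Definition disjoint_query (q : query) : bool := [disjoint vars q.1 & vars q.2].

Definition event_prob (f : assignment -> R) (E : pred assignment) : R :=
  \sum_(a | E a) f a.

(* f(x | y), equal to 0 when f(y) = 0. *)
Definition cond_prob (f : assignment -> R) (q : query) : R :=
  event_prob f (fun a => agrees a q.1 && agrees a q.2) /
  event_prob f (fun a => agrees a q.2).

Definition legal (p : dist R assignment) (q : query) : bool :=
  disjoint_query q && (0 < event_prob p (fun a => agrees a q.2)).

(* bn_arc j i means that j is a parent of i; a closed walk is a nonempty sequence
   satisfying cycle, a self-loop being one of length 1. *)
Record bayes_net := BayesNet {
  bn_arc : rel V;
  bn_acyclic : forall c : seq V, cycle bn_arc c -> c = [::];
  cpt : forall i : V,
    {dffun forall j : {j : V | bn_arc j i}, dom (val j)} -> dist R (dom i) }.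

Definition parent_values (B : bayes_net) (a : assignment) (i : V) :
    {dffun forall j : {j : V | bn_arc B j i}, dom (val j)} :=
  [ffun j => a (val j)].

Definition bn_joint (B : bayes_net) (a : assignment) : R :=
  \prod_i cpt (parent_values B a i) (a i).

(* A query legal for p may condition on an event that B deems impossible; B's
   conditional probability is then undefined, and the value returned is given
   by dflt. *)
Definition bn_answer (B : bayes_net) (dflt : query -> R) (q : query) : R :=
  if event_prob (bn_joint B) (fun a => agrees a q.2) == 0 then dflt q
  else cond_prob (bn_joint B) q.

Definition err (p : dist R assignment) (sq : dist R query) (b : query -> R) :
    R :=
  \sum_(q : query | disjoint_query q) sq q * (b q - cond_prob p q) ^+ 2.

Definition label (p : dist R assignment) (m : nat) (s : {ffun 'I_m -> query}) :
    {ffun 'I_m -> query * R} :=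
  [ffun k => (s k, cond_prob p (s k))].

Definition emp_err (b : query -> R) (m : nat) (S : {ffun 'I_m -> query * R}) :
    R :=
  m%:R^-1 * \sum_k (b (S k).1 - (S k).2) ^+ 2.

End Queries.

Definition M_LSQ (R : realType) (eps delta : R) : nat :=
  `|Num.ceil (1 / (2 * eps ^+ 2) * ln (2 / delta))|%N.

(* Main.v *)
Require Import Defs.
From mathcomp Require Import all_boot all_order all_algebra.
From mathcomp Require Import ring lra.
From mathcomp Require Import reals classical_sets functions topology normedtype sequences derive realfun exp.

Set Implicit Arguments.
Unset Strict Implicit.
Unset Printing Implicit Defensive.

Import Order.TTheory GRing.Theory Num.Theory.
Import numFieldNormedType.Exports.
Local Open Scope classical_set_scope.
Local Open Scope ring_scope.

(** Hoeffding's bound with the variables [(B(q) - p(q))^2], which lie in [0, 1]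
and have mean [err(B)].  By convexity of [exp] and the inequality
[1 - u + u e^x <= e^(u x + x^2 / 8)], the centred moment generating function is
at most [e^(x^2 / 8)]; Markov's inequality at [x = 4 eps] then bounds each tail
by [e^(- 2 M eps^2)], and [M_LSQ] is the least [M] for which twice this
quantity is at most [delta]. *)

(** * Moment generating function of a Bernoulli variable *)

Section HoeffdingLemma.
Variable R : realType.
Implicit Types (u x : R).

Lemma le_of_derive_ge0 (f df : R -> R) x :
  (forall z, is_derive z (1 : R) f (df z)) -> (forall z, 0 <= z -> 0 <= df z) ->
  0 <= x -> f 0 <= f x.
Proof.
move=> fdf df_ge0 x_ge0.
have fC : {within `[0, x], continuous f}.
  by apply: derivable_within_continuous => z _; have [] := fdf z.
have [c c_itv fE] := MVT_segment x_ge0 (fun z _ => fdf z) fC.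
have c_ge0 : 0 <= c by rewrite (itvP c_itv).
by rewrite -subr_ge0 fE mulr_ge0 ?subr_ge0 ?df_ge0.
Qed.

Lemma bernoulli_mgf_gt0 u x : 0 <= u <= 1 -> 0 < 1 - u + u * expR x.
Proof. by move=> u01; have := expR_gt0 x; nra. Qed.

Lemma is_derive_bernoulli_mgf u x :
  is_derive x (1 : R) (fun z => 1 - u + u * expR z) (u * expR x).
Proof.
have -> : (fun z => 1 - u + u * expR z) = cst (1 - u) + u \*: expR :> (R -> R).
  by [].
by apply: is_derive_eq; rewrite add0r.
Qed.

(** The left side is the derivative of the logarithm of the moment generating function. It equals
    [u] at 0, and its own derivative is a Bernoulli variance [w * (1 - w)], hence at most 1/4. *)
Lemma bernoulli_mgf_derive_le u x : 0 <= u <= 1 -> 0 <= x ->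
  u * expR x / (1 - u + u * expR x) <= u + x / 4.
Proof.
move=> u01 x_ge0; pose D z := 1 - u + u * expR z.
have D_gt0 z : 0 < D z by exact: bernoulli_mgf_gt0.
have D_neq0 z : D z != 0 by rewrite gt_eqF.
(* Since [u * expR z / D z = 1 - (1 - u) / D z], the claim amounts to [f 0 <= f x]. *)
pose f z := z / 4 + (1 - u) / D z.
pose df z := 1 / 4 - (1 - u) * (u * expR z) / D z ^+ 2.
have fdf z : is_derive z (1 : R) f (df z).
  have dD := is_derive_bernoulli_mgf u z.
  have dV := is_deriveV (D_neq0 z) dD.
  have -> : f = 4^-1 \*: id + (1 - u) \*: (fun y => (D y)^-1).
    by apply/boolp.funext => y; rewrite /f /= mulrC.
  apply: is_derive_eq; rewrite /df /GRing.scale /=.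
  by field.
have df_ge0 z : 0 <= z -> 0 <= df z.
  move=> _; rewrite /df subr_ge0 ler_pdivrMr ?exprn_gt0 // /D.
  (* AM-GM for the two summands of [D z]: the square is [D z ^+ 2 - 4 * (1 - u) * (u * expR z)]. *)
  by have := sqr_ge0 (1 - u - u * expR z); nra.
have := le_of_derive_ge0 fdf df_ge0 x_ge0.
rewrite /f /D expR0 mul0r add0r mulr1 subrK divr1.
suff -> : u * expR x / D x = 1 - (1 - u) / D x by rewrite /D; lra.
have -> : u * expR x = D x - (1 - u) by rewrite /D; ring.
by rewrite mulrBl divff.
Qed.

(** Integrates the preceding bound: the logarithm of the left side vanishes at 0 and has derivative
    at most [u + z / 4] at each [z >= 0]. *)
Lemma bernoulli_mgf_le u x : 0 <= u <= 1 -> 0 <= x ->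
  1 - u + u * expR x <= expR (u * x + x ^+ 2 / 8).
Proof.
move=> u01 x_ge0; pose D z := 1 - u + u * expR z.
have D_gt0 z : 0 < D z by exact: bernoulli_mgf_gt0.
pose f z := u * z + z ^+ 2 / 8 - ln (D z).
pose df z := u + z / 4 - u * expR z / D z.
have fdf z : is_derive z (1 : R) f (df z).
  have dD := is_derive_bernoulli_mgf u z.
  have dl := is_derive1_ln (D_gt0 z).
  have dc := is_derive1_comp dl dD.
  have -> : f = u \*: id + 8^-1 \*: (id ^+ 2) - (@ln R \o D).
    by apply/boolp.funext => y; rewrite /f /= [_ / 8]mulrC.
  apply: is_derive_eq; rewrite /df /GRing.scale /=.
  by field; rewrite gt_eqF.
have df_ge0 z : 0 <= z -> 0 <= df z.
  by move=> z_ge0; rewrite subr_ge0 bernoulli_mgf_derive_le.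
have := le_of_derive_ge0 fdf df_ge0 x_ge0.
rewrite /f {1}/D expR0 mulr1 subrK ln1 mulr0 expr0n mul0r addr0 subr0 subr_ge0.
by rewrite -ler_expR lnK ?posrE.
Qed.

(** The tangent at [y = x * t] lies below [expR] at 0 and at [x]; averaging with weights [1 - t] and
    [t] cancels the linear terms and leaves [expR y]. *)
Lemma expR_chord_le x (t : R) : 0 <= t <= 1 ->
  expR (x * t) <= 1 - t + t * expR x.
Proof.
move=> /andP[t_ge0 t_le1]; set y := x * t.
have tangent z : expR y * (1 + (z - y)) <= expR z.
  rewrite -[in leRHS](subrKC y z) expRD.
  by rewrite ler_wpM2l ?expR_ge0 ?expR_ge1Dx.
have := tangent 0; rewrite expR0 => tangent0; have := tangent x.
have -> : expR y = (1 - t) * (expR y * (1 + (0 - y)))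
                   + t * (expR y * (1 + (x - y))) by rewrite /y; ring.
move=> tangentx; rewrite lerD ?ler_wpM2l //.
by rewrite -[leRHS]mulr1 ler_wpM2l // subr_ge0.
Qed.

End HoeffdingLemma.

(** * Tail bounds for means of independent samples *)

Section Hoeffding.
Variables (R : realType) (T : finType).
Implicit Types (d : dist R T) (f : T -> R).

Lemma PrC (S : finType) (d : dist R S) (E : pred S) :
  Pr d E = 1 - Pr d (predC E).
Proof.
by apply/eqP; rewrite eq_sym subr_eq -(pmf_sum1 d) (bigID E).
Qed.

Lemma mean_itv d f : (forall t, 0 <= f t <= 1) -> 0 <= \sum_t d t * f t <= 1.
Proof.
move=> f01; apply/andP; split.
  apply: sumr_ge0 => t _; have /andP[f0 _] := f01 t.
  by rewrite mulr_ge0 ?pmf_ge0.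
rewrite -(pmf_sum1 d) ler_sum // => t _.
by have /andP[_ f1] := f01 t; rewrite ler_piMr ?pmf_ge0.
Qed.

(** Averaging the chord bound over [d] replaces [f] by a Bernoulli variable with the same mean. *)
Lemma hoeffding_mgf d f x : (forall t, 0 <= f t <= 1) -> 0 <= x ->
  \sum_t d t * expR (x * f t) <= expR (x * (\sum_t d t * f t) + x ^+ 2 / 8).
Proof.
move=> f01 x_ge0; rewrite [x * _]mulrC.
apply: le_trans (bernoulli_mgf_le (mean_itv d f01) x_ge0).
rewrite mulr_suml -(pmf_sum1 d) -sumrB -big_split ler_sum // => t _.
apply: le_trans (ler_wpM2l (pmf_ge0 d t) (expR_chord_le x (f01 t))) _ => /=.
by rewrite mulrDr mulrBr mulr1 mulrA.
Qed.

Lemma hoeffding_upper_tail d f m (eps : R) :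
    (forall t, 0 <= f t <= 1) -> 0 <= eps ->
  Pr (iid d m) (fun s => m%:R * (\sum_t d t * f t + eps) <= \sum_k f (s k))
    <= expR (- (2 * m%:R * eps ^+ 2)).
Proof.
move=> f01 eps_ge0; set u := \sum_t d t * f t.
(* This [x] minimises the final exponent [m * (x ^+ 2 / 8 - x * eps)], with value
   [- 2 * m * eps ^+ 2]. *)
pose x := 4 * eps; have x_ge0 : 0 <= x by rewrite mulr_ge0.
pose c := x * (m%:R * (u + eps)).
(* Markov's inequality: the indicator of the event is at most [expR (x * \sum_k f (s k) - c)]. *)
apply: (@le_trans _ _
  (\sum_s iid d m s * (expR (x * \sum_k f (s k)) * expR (- c)))).
  rewrite /Pr big_mkcond ler_sum // => s _.
  case: ifP => [le_s | _]; last by rewrite !mulr_ge0 ?pmf_ge0 ?expR_ge0.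
  by rewrite ler_peMr ?pmf_ge0 // -expRD -expR0 ler_expR subr_ge0 ler_wpM2l.
under eq_bigr => s _.
  rewrite mulrA mulr_sumr expR_sum -big_split /=.
  over.
(* Independence: the expectation of the product over the draws is the product of [m] equal
   expectations. *)
rewrite -mulr_suml -(bigA_distr_bigA (fun (_ : 'I_m) t => d t * expR (x * f t))).
rewrite prodr_const card_ord.
apply: (@le_trans _ _ (expR (x * u + x ^+ 2 / 8) ^+ m * expR (- c))).
  rewrite ler_pM2r ?expR_gt0 // lerXn2r ?nnegrE ?expR_ge0 ?hoeffding_mgf //.
  by apply: sumr_ge0 => t _; rewrite mulr_ge0 ?pmf_ge0 ?expR_ge0.
by rewrite -expRM_natl -expRD ler_expR /c /x -mulr_natl; lra.
Qed.

(** The upper tail bound applied to [1 - f]. *)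
Lemma hoeffding_lower_tail d f m (eps : R) :
    (forall t, 0 <= f t <= 1) -> 0 <= eps ->
  Pr (iid d m) (fun s => \sum_k f (s k) <= m%:R * (\sum_t d t * f t - eps))
    <= expR (- (2 * m%:R * eps ^+ 2)).
Proof.
move=> f01 eps_ge0; pose g t := 1 - f t.
have g01 t : 0 <= g t <= 1 by rewrite /g; have := f01 t; lra.
apply: le_trans (hoeffding_upper_tail d m g01 eps_ge0).
rewrite le_eqVlt; apply/orP; left; apply/eqP/eq_bigl => s.
have -> : \sum_t d t * g t = 1 - \sum_t d t * f t.
  rewrite -(pmf_sum1 d) -sumrB; apply: eq_bigr => t _.
  by rewrite mulrBr mulr1.
have -> : \sum_k g (s k) = m%:R - \sum_k f (s k).
  by rewrite sumrB sumr_const card_ord.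
by apply/idP/idP; lra.
Qed.

Lemma hoeffding d f m (eps : R) : (0 < m)%N ->
    (forall t, 0 <= f t <= 1) -> 0 <= eps ->
  1 - 2 * expR (- (2 * m%:R * eps ^+ 2)) <=
  Pr (iid d m) (fun s => `|m%:R^-1 * \sum_k f (s k) - \sum_t d t * f t| < eps).
Proof.
move=> m_gt0 f01 eps_ge0; rewrite PrC lerD2l lerN2.
have m_gt0R : 0 < m%:R :> R by rewrite ltr0n.
rewrite [leRHS]mulr_natl mulr2n.
apply: le_trans (lerD (hoeffding_upper_tail d m f01 eps_ge0)
                      (hoeffding_lower_tail d m f01 eps_ge0)).
(* Union bound, sample by sample: a deviation of at least [eps] falls in one of the two tails. *)
rewrite /Pr [leLHS]big_mkcond [X in _ <= X + _]big_mkcond.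
rewrite [X in _ <= _ + X]big_mkcond -big_split ler_sum //= => s _.
have := iid_pmf_ge0 d s.
rewrite -leNgt ler_normr lerBrDr lerNr lerBlDr.
rewrite [_^-1 * _]mulrC ler_pdivlMr // ler_pdivrMr // ![_ * m%:R]mulrC.
rewrite [eps + _]addrC [- eps + _]addrC.
by case: (_ <= \sum_k f (s k)); case: (\sum_k f (s k) <= _) => /=; lra.
Qed.

End Hoeffding.

(** * Range of the answers, and the error as an expectation *)

Section Answers.
Variables (R : realType) (V : finType) (dom : V -> finType).

Lemma cond_prob_itv (f : assignment dom -> R) q :
  (forall a, 0 <= f a) -> 0 <= cond_prob f q <= 1.
Proof.
move=> f_ge0; rewrite /cond_prob.
set n := event_prob f _; set D := event_prob f _.
have n_ge0 : 0 <= n by apply: sumr_ge0.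
have D_ge0 : 0 <= D by apply: sumr_ge0.
have n_leD : n <= D.
  rewrite /n /D /event_prob [leRHS](bigID (fun a => agrees a q.1)) /=.
  under eq_bigl do rewrite andbC.
  by rewrite lerDl sumr_ge0.
rewrite divr_ge0 //=.
(* When the conditioning event has mass 0, the quotient is 0 by the convention for inverses. *)
move: D_ge0; rewrite le_eqVlt => /predU1P[<-|D_gt0].
  by rewrite invr0 mulr0.
by rewrite ler_pdivrMr // mul1r.
Qed.

Lemma bn_answer_itv (B : bayes_net R dom) dflt q :
  (forall q, 0 <= dflt q <= 1) -> 0 <= bn_answer B dflt q <= 1.
Proof.
move=> dflt01; rewrite /bn_answer; case: ifP => // _.
by apply: cond_prob_itv => a; apply: prodr_ge0 => i _; apply: pmf_ge0.
Qed.

(** Overlapping queries are illegal, so [sq] gives them mass 0; the error is then a full expectation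
    under [sq], as Hoeffding's bound requires. *)
Lemma err_legal (p : dist R (assignment dom)) (sq : dist R (query dom)) b :
  (forall q, sq q != 0 -> legal p q) ->
  err p sq b = \sum_q sq q * (b q - cond_prob p q) ^+ 2.
Proof.
move=> sq_legal; rewrite /err big_mkcond; apply: eq_bigr => q _.
case: ifPn => // q_ndisj; have [-> | /sq_legal] := eqVneq (sq q) 0.
  by rewrite mul0r.
by rewrite /legal (negPf q_ndisj).
Qed.

End Answers.

Lemma M_LSQ_ge (R : realType) (eps delta : R) :
  1 / (2 * eps ^+ 2) * ln (2 / delta) <= (M_LSQ eps delta)%:R.
Proof.
rewrite /M_LSQ natr_absz; apply: le_trans (ceil_ge _) _.
by rewrite ler_int ler_norm.
Qed.

Theorem theorem3 (R : realType) (V : finType) (dom : V -> finType)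
    (p : dist R (assignment dom))
    (sq : dist R (query dom))
    (sq_legal : forall q, sq q != 0 -> legal p q)
    (B : bayes_net R dom)
    (dflt : query dom -> R)
    (dflt01 : forall q, 0 <= dflt q <= 1)
    (eps delta : R)
    (eps01 : 0 < eps < 1) (delta01 : 0 < delta < 1) :
  Pr (iid sq (M_LSQ eps delta))
     (fun s => `|emp_err (bn_answer B dflt) (label p s)
                 - err p sq (bn_answer B dflt)| < eps)
  >= 1 - delta.
Proof.
have [/andP[eps_gt0 _] /andP[delta_gt0 delta_lt1]] := (eps01, delta01).
(* Makes the logarithm in [M_LSQ] positive, so that the sample is nonempty. *)
have two_delta_gt1 : 1 < 2 / delta by rewrite ltr_pdivlMr //; lra.
have den_gt0 : 0 < 2 * eps ^+ 2 by rewrite mulr_gt0 ?exprn_gt0.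
have M_ge := M_LSQ_ge eps delta; set M := M_LSQ eps delta in M_ge *.
have M_gt0 : (0 < M)%N.
  rewrite -(ltr0n R); apply: lt_le_trans M_ge.
  by rewrite mulr_gt0 ?divr_gt0 ?ln_gt0.
(* Taking logarithms and solving for [M] turns this into [M_ge]. *)
have tail_le : 2 * expR (- (2 * M%:R * eps ^+ 2)) <= delta.
  rewrite expRN ler_pdivrMr ?expR_gt0 // [delta * _]mulrC -ler_pdivrMr //.
  rewrite -[_ / delta]lnK ?posrE ?divr_gt0 // ler_expR.
  rewrite [leRHS]mulrAC [leRHS]mulrC -ler_pdivrMr // [leLHS]mulrC.
  by rewrite -[_^-1]mul1r.
pose f q := (bn_answer B dflt q - cond_prob p q) ^+ 2.
have f01 q : 0 <= f q <= 1.
  have := bn_answer_itv B q dflt01; have := cond_prob_itv q (pmf_ge0 p).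
  rewrite /f sqr_ge0 /=; move: (cond_prob p q) (bn_answer B dflt q) => a b.
  by move=> a01 b01; rewrite -subr_ge0 -[1](expr1n R 2) subr_sqr mulr_ge0; lra.
apply: le_trans (_ : 1 - 2 * expR (- (2 * M%:R * eps ^+ 2)) <= _).
  by rewrite lerD2l lerN2.
have := hoeffding sq M_gt0 f01 (ltW eps_gt0).
rewrite err_legal //; congr (_ <= _); apply: eq_bigl => s.
rewrite /emp_err; under [in RHS]eq_bigr do rewrite ffunE.
by [].
Qed.
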